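(* Let $n\in\mathbb{N}$ with $n\geq 2$, let $\beta\in\{1,\dots,n-1\}$, and let $c_1,\dots,c_{n-1}\in\mathbb{R}$. Then the function $u:\mathbb{R}^n\to\mathbb{R}$ given by $$u(x_1,\dots,x_n)=\left[\frac{1}{\beta}\sum_{k=1}^{\beta}c_k\right]x_n+\sum_{k=1}^{n-1}c_kx_k$$ solves the partial differential equation $$\sum_{k=1}^{\beta}\frac{\partial u}{\partial x_k}=\beta\frac{\partial u}{\partial x_n}.$$ *)

(* Defs.v *)
From HB Require Import structures.
From mathcomp Require Import all_boot all_order all_algebra.
From mathcomp Require Import all_classical all_reals all_analysis.

Set Implicit Arguments.
Unset Strict Implicit.
Unset Printing Implicit Defensive.

Import Order.TTheory GRing.Theory Num.Theory.
Import numFieldNormedType.Exports.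

Local Open Scope classical_set_scope.
Local Open Scope ring_scope.

(* Ordinals count from 0: the variable x_k (1 <= k <= n) is the coordinate of
   index k - 1 of a row vector. In particular, the k-th variable for k <= n - 1
   is [initvar] of an ordinal of 'I_n.-1, and x_n is [lastvar]. *)
Definition initvar (n : nat) (k : 'I_n.-1) : 'I_n := widen_ord (leq_pred n) k.

Fact lastvar_subproof (n : nat) (hn : (2 <= n)%N) : (n.-1 < n)%N.
Proof. by rewrite ltn_predL; apply: leq_trans hn. Qed.

Definition lastvar (n : nat) (hn : (2 <= n)%N) : 'I_n :=
  Ordinal (lastvar_subproof hn).

Section pde.
Context {R : realType} {n : nat}.
Implicit Types (u : 'rV[R]_n -> R) (x : 'rV[R]_n) (i : 'I_n).

Definition has_partial i u x : Prop := derivable u x (delta_mx 0 i).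

Definition partial i u x : R := 'D_(delta_mx 0 i) u x.

Definition C1 u : Prop :=
  forall i, (forall x, has_partial i u x) /\ continuous (partial i u).

(* Classical solutions on the whole space. The C1 requirement matters because
   ['D_v u x] is a junk value when the derivative does not exist. *)
Definition solves_pde (hn : (2 <= n)%N) (beta : nat) u : Prop :=
  C1 u /\
  forall x, \sum_(k < n | (k < beta)%N) partial k u x =
            beta%:R * partial (lastvar hn) u x.

End pde.

(* Main.v *)
Require Import Defs.
From HB Require Import structures.
From mathcomp Require Import all_boot all_order all_algebra.
From mathcomp Require Import all_classical all_reals all_analysis.

Import Order.TTheory GRing.Theory Num.Theory.
Import numFieldNormedType.Exports.

Local Open Scope ring_scope.

(** The function [u] is a linear form, so its derivative in the direction [v]
    is the constant [u v] ([is_derive_scalar]); in particular [u] is C1, with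
    partial derivatives its values on the canonical basis. On a basis vector
    of index [k < n - 1] the form takes the value [c k], and on the last one
    the mean of the first [beta] coefficients. Since [beta <= n - 1], the left
    side of the equation only meets vectors of the first kind: it is the sum
    of the first [beta] coefficients, which is [beta] times their mean. *)

(** By linearity, the difference quotient in the direction [v] is equal to
    [f v] for every nonzero increment, so it converges trivially. *)
Lemma is_derive_scalar (R : realType) (V : normedModType R)
    (f : V -> R) (x v : V) : scalar f -> is_derive x v f (f v).
Proof.
move=> f_lin.
have quot_cvg :
    ((fun h : R => h^-1 *: (f (h *: v + x) - f x)) @ 0^' --> f v)%classic.
  apply: cvg_near_cst; near=> h.
  have h_neq0 : h != 0 by near: h; exact: nbhs_dnbhs_neq.
  by rewrite f_lin addrK /= [LHS]mulrA mulVf // mul1r.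
apply: DeriveDef; first by apply/cvg_ex; exists (f v); exact: quot_cvg.
exact: cvg_lim quot_cvg.
Unshelve. all: by end_near. Qed.

Section ScalarPartial.
Context {R : realType} {n : nat} {f : 'rV[R]_n -> R}.
Hypothesis f_lin : scalar f.

Lemma partial_scalar i : partial i f = fun=> f (delta_mx 0 i).
Proof.
apply/funext => x.
exact: (@derive_val _ _ _ _ _ _ _ (@is_derive_scalar _ _ f x _ f_lin)).
Qed.

Lemma C1_scalar : C1 f.
Proof.
move=> i; split=> [x|]; last by rewrite partial_scalar; exact: cst_continuous.
exact: (@ex_derive _ _ _ _ _ _ _ (@is_derive_scalar _ _ f x _ f_lin)).
Qed.

End ScalarPartial.

Section LastInitForm.
Context {R : realType} {n : nat} (hn : (2 <= n)%N).
Variables (a : R) (c : 'I_n.-1 -> R).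

Definition last_init_form (x : 'rV[R]_n) : R :=
  a * x 0 (lastvar hn) + \sum_(k < n.-1) c k * x 0 (initvar k).

Lemma last_init_form_scalar : scalar last_init_form.
Proof.
move=> h x y; rewrite /last_init_form !mxE mulrDr mulrCA.
under eq_bigr do rewrite !mxE mulrDr mulrCA.
by rewrite big_split /= -mulr_sumr [h * (_ + _)]mulrDr addrACA.
Qed.

Lemma initvar_neq_last (k : 'I_n.-1) : (initvar k == lastvar hn) = false.
Proof. by rewrite -val_eqE /= ltn_eqF. Qed.

Lemma last_init_form_last : last_init_form (delta_mx 0 (lastvar hn)) = a.
Proof.
rewrite /last_init_form mxE !eqxx mulr1 big1 ?addr0 // => k _.
by rewrite mxE initvar_neq_last andbF mulr0.
Qed.

Lemma last_init_form_init k : last_init_form (delta_mx 0 (initvar k)) = c k.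
Proof.
rewrite /last_init_form mxE [lastvar hn == _]eq_sym initvar_neq_last.
rewrite andbF mulr0 add0r (bigD1 k) //= mxE !eqxx mulr1 big1 ?addr0 // => j jk.
(* Equality of ordinals compares values, which [initvar] preserves. *)
by rewrite mxE -[initvar j == _]/(j == k) (negPf jk) andbF mulr0.
Qed.

End LastInitForm.

(** The bound on [b] excludes the last index from the sum. *)
Lemma sum_below_initvar (V : nmodType) (n b : nat) (F : 'I_n -> V) :
  (b <= n.-1)%N ->
  \sum_(k < n | (k < b)%N) F k = \sum_(k < n.-1 | (k < b)%N) F (initvar k).
Proof.
case: n F => [|m] F /= b_le; first by rewrite !big_ord0.
rewrite big_mkcond big_ord_recr /= ltnNge b_le addr0 -big_mkcond /=.
by apply: eq_bigr => k _; congr F; exact: val_inj.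
Qed.

Theorem proposition2 (R : realType) (n : nat) (hn : (2 <= n)%N)
    (beta : nat) (hbeta : (1 <= beta <= n - 1)%N) (c : 'I_n.-1 -> R) :
  solves_pde hn beta
    (fun x : 'rV[R]_n =>
       (1 / beta%:R * \sum_(k < n.-1 | (k < beta)%N) c k) * x 0 (lastvar hn)
       + \sum_(k < n.-1) c k * x 0 (initvar k)).
Proof.
have /andP[beta_gt0] := hbeta; rewrite subn1 => beta_le.
set a := 1 / _ * _.
rewrite -[X in solves_pde _ _ X]/(last_init_form hn a c).
have u_lin := last_init_form_scalar hn a c.
split=> [|x]; first exact: C1_scalar.
rewrite partial_scalar // last_init_form_last sum_below_initvar //.
under eq_bigr do rewrite partial_scalar // last_init_form_init.
by rewrite /a mulrA mul1r divff ?mul1r // pnatr_eq0 -lt0n.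
Qed.
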